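(* Let $(\mathbf V,\otimes,\mathbf 1)$ be a monoidal category with pullbacks and let $p:\mathcal E\to\mathcal B$ be an opfibration of $\mathbf V$-categories. The map $\mathcal E_\bullet:\mathcal B_0\to\mathbf V\text{-}\mathsf{Cat}$ sending an object $b$ to the fiber $\mathcal E_b$ and a morphism $f:b\to b'$ of $\mathcal B_0$ to the transport functor $f_!:\mathcal E_b\to\mathcal E_{b'}$ can be given the structure of a pseudofunctor.
   Context: **Enriched conventions.** $\mathbf V$ is locally small; $\mathbf V\text{-}\mathsf{Cat}$ is the strict $2$-category of small $\mathbf V$-categories, $\mathbf V$-functors and $\mathbf V$-natural transformations. A map $f:\mathbf 1\to\mathcal C(b,c)$ is a morphism $b\to c$ in the underlying category $\mathcal C_0$; it induces $-\circ f:\mathcal C(c,d)\to\mathcal C(b,d)$ and $f\circ-:\mathcal C(a,b)\to\mathcal C(a,c)$. For a $\mathbf V$-functor $p$, $pf$ denotes $f$ followed by the hom-map of $p$; $f$ lies over $pf$, and an object $e$ lies over $pe$. **Opfibrations.** A map $\chi:\mathbf 1\to\mathcal E(e,e')$ is $p$-opcartesian if for all $d\in\mathcal E$ the square with top $-\circ\chi:\mathcal E(e',d)\to\mathcal E(e,d)$, bottom $-\circ p\chi:\mathcal B(pe',pd)\to\mathcal B(pe,pd)$ and vertical maps given by $p$ is a pullback in $\mathbf V$. An opfibration is a $\mathbf V$-functor $p:\mathcal E\to\mathcal B$ along with, for every $e\in\mathcal E$, $b\in\mathcal B$, $f:\mathbf 1\to\mathcal B(pe,b)$, a chosen object $f_!e$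 over $b$ and a chosen $p$-opcartesian map $\chi(f,e):\mathbf 1\to\mathcal E(e,f_!e)$ over $f$. **Fibers and transport.** The fiber $\mathcal E_b$ has objects those $e\in\mathcal E$ with $pe=b$, and $\mathcal E_b(e,e')$ is the pullback of $p:\mathcal E(e,e')\to\mathcal B(b,b)$ along $1_b:\mathbf 1\to\mathcal B(b,b)$. For $f\in\mathcal B_0(b,b')$, the transport $f_!:\mathcal E_b\to\mathcal E_{b'}$ is the $\mathbf V$-functor with $e\mapsto f_!e$ on objects, whose hom-map $\mathcal E_b(e,e')\to\mathcal E_{b'}(f_!e,f_!e')$ is the unique $\mathbf V$-morphism compatible with the projections to $\mathbf 1$ such that following it by $\mathcal E_{b'}(f_!e,f_!e')\to\mathcal E(f_!e,f_!e')\xrightarrow{-\circ\chi(f,e)}\mathcal E(e,f_!e')$ gives $\mathcal E_b(e,e')\to\mathcal E(e,e')\xrightarrow{\chi(f,e')\circ-}\mathcal E(e,f_!e')$. **Pseudofunctors.** A pseudofunctor $F:B\to\mathbf V\text{-}\mathsf{Cat}$ from an ordinary category $B$ consists of $\mathbf V$-categories $F_b$, $\mathbf V$-functors $F_f:F_b\to F_c$ ($f:b\to c$), natural isomorphisms $\xi(b):F_{1_b}\cong1_{F_b}$ and $\theta(f,g):F_{gf}\cong F_gF_f$ such that, for $f:b\to c$, $g:c\to d$, $h:d\to e$: $(F_f\xi(b))\cdot\theta(1_b,f)=1_{F_f}$, $(\xi(c)F_f)\cdot\theta(f,1_c)=1_{F_f}$, $(F_h\theta(f,g))\cdot\theta(gf,h)=(\theta(g,h)F_f)\cdot\theta(f,hg)$.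 *)

(* Defs.v *)
From Corelib Require Import ssreflect ssrfun.
From Stdlib Require Import IndefiniteDescription.

Set Implicit Arguments.
Unset Strict Implicit.
Unset Printing Implicit Defensive.

Declare Scope cat_scope.
Delimit Scope cat_scope with cat.
Open Scope cat_scope.

Record Category := {
  ob :> Type;
  hom : ob -> ob -> Type;
  idm : forall a, hom a a;
  comp : forall a b c, hom b c -> hom a b -> hom a c;
  comp_id_l : forall a b (f : hom a b), comp (idm b) f = f;
  comp_id_r : forall a b (f : hom a b), comp f (idm a) = f;
  compA : forall a b c d (h : hom c d) (g : hom b c) (f : hom a b),
    comp h (comp g f) = comp (comp h g) f }.

Arguments idm {_} a.
Arguments hom {_} a b.

Notation "g ∘ f" := (comp g f) (at level 40, left associativity) : cat_scope.

Definition is_pullback (C : Category) (P A B D : C) (p1 : hom P A) (p2 : hom P B)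
    (f : hom A D) (g : hom B D) : Prop :=
  f ∘ p1 = g ∘ p2 /\
  forall (Q : C) (q1 : hom Q A) (q2 : hom Q B), f ∘ q1 = g ∘ q2 ->
    exists! u : hom Q P, p1 ∘ u = q1 /\ p2 ∘ u = q2.

Record Pullback (C : Category) (A B D : C) (f : hom A D) (g : hom B D) := {
  pb :> C;
  pb_fst : hom pb A;
  pb_snd : hom pb B;
  pb_isP : is_pullback pb_fst pb_snd f g }.

Arguments pb_fst {_ _ _ _ _ _} _.
Arguments pb_snd {_ _ _ _ _ _} _.

(* A choice of pullback for every cospan; fibers are built from it. *)
Definition HasPullbacks (C : Category) : Type :=
  forall (A B D : C) (f : hom A D) (g : hom B D), Pullback f g.

Lemma pullback_jointly_monic (C : Category) (P A B D : C) (p1 : hom P A)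
    (p2 : hom P B) (f : hom A D) (g : hom B D) :
  is_pullback p1 p2 f g ->
  forall (Q : C) (u v : hom Q P), p1 ∘ u = p1 ∘ v -> p2 ∘ u = p2 ∘ v -> u = v.
Proof.
move=> [e H] Q u v e1 e2.
have eq : f ∘ (p1 ∘ v) = g ∘ (p2 ∘ v) by rewrite !compA e.
have [w [_ Hw]] := H _ _ _ eq.
by rewrite -(Hw u) // -(Hw v).
Qed.

Section PullbackLift.
Variables (C : Category) (A B D : C) (f : hom A D) (g : hom B D).
Variables (P : Pullback f g) (Q : C) (q1 : hom Q A) (q2 : hom Q B).
Hypothesis eq : f ∘ q1 = g ∘ q2.

Lemma pb_lift_subproof : exists u : hom Q P, pb_fst P ∘ u = q1 /\ pb_snd P ∘ u = q2.
Proof. by case: (proj2 (pb_isP P) _ _ _ eq) => u [Hu _]; exists u. Qed.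

Definition pb_lift : hom Q P :=
  proj1_sig (constructive_indefinite_description _ pb_lift_subproof).

Lemma pb_lift_fst : pb_fst P ∘ pb_lift = q1.
Proof. by rewrite /pb_lift; case: constructive_indefinite_description => u []. Qed.

Lemma pb_lift_snd : pb_snd P ∘ pb_lift = q2.
Proof. by rewrite /pb_lift; case: constructive_indefinite_description => u []. Qed.
End PullbackLift.

Record MonoidalCategory := {
  mcat :> Category;
  munit : mcat;
  tens : mcat -> mcat -> mcat;
  tensm : forall a b c d : mcat,
    hom a b -> hom c d -> hom (tens a c) (tens b d);
  assoc : forall a b c, hom (tens (tens a b) c) (tens a (tens b c));
  assoc' : forall a b c, hom (tens a (tens b c)) (tens (tens a b) c);
  lunit : forall a, hom (tens munit a) a;
  lunit' : forall a, hom a (tens munit a);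
  runit : forall a, hom (tens a munit) a;
  runit' : forall a, hom a (tens a munit);
  tensm_id : forall a b : mcat, tensm (idm a) (idm b) = idm (tens a b);
  tensm_comp : forall (a b c a' b' c' : mcat) (g : hom b c) (f : hom a b)
    (g' : hom b' c') (f' : hom a' b'),
    tensm (g ∘ f) (g' ∘ f') = tensm g g' ∘ tensm f f';
  assocK : forall a b c, assoc' a b c ∘ assoc a b c = idm _;
  assoc'K : forall a b c, assoc a b c ∘ assoc' a b c = idm _;
  lunitK : forall a, lunit' a ∘ lunit a = idm _;
  lunit'K : forall a, lunit a ∘ lunit' a = idm _;
  runitK : forall a, runit' a ∘ runit a = idm _;
  runit'K : forall a, runit a ∘ runit' a = idm _;
  assoc_nat : forall (a b c a' b' c' : mcat)
    (f : hom a a') (g : hom b b') (h : hom c c'),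
    assoc a' b' c' ∘ tensm (tensm f g) h = tensm f (tensm g h) ∘ assoc a b c;
  lunit_nat : forall (a b : mcat) (f : hom a b),
    lunit b ∘ tensm (idm munit) f = f ∘ lunit a;
  runit_nat : forall (a b : mcat) (f : hom a b),
    runit b ∘ tensm f (idm munit) = f ∘ runit a;
  triangle : forall a b,
    tensm (idm a) (lunit b) ∘ assoc a munit b = tensm (runit a) (idm b);
  pentagon : forall a b c d,
    tensm (idm a) (assoc b c d) ∘ assoc a (tens b c) d ∘ tensm (assoc a b c) (idm d)
    = assoc a b (tens c d) ∘ assoc (tens a b) c d }.

Arguments munit {_}.
Arguments assoc {_} a b c.
Arguments assoc' {_} a b c.
Arguments lunit {_} a.
Arguments lunit' {_} a.
Arguments runit {_} a.
Arguments runit' {_} a.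

Notation "a ⊗ b" := (tens a b) (at level 36, left associativity) : cat_scope.
Notation "f ⊠ g" := (tensm f g) (at level 36, left associativity) : cat_scope.
Notation "𝟏" := munit (at level 0) : cat_scope.

Lemma reassoc (C : Category) (a b c : C) (g : hom b c) (f : hom a b) (k : hom a c) :
  g ∘ f = k -> forall (z : C) (r : hom z a), g ∘ (f ∘ r) = k ∘ r.
Proof. by move=> <- z r; rewrite compA. Qed.

Lemma epi_of_section (C : Category) (a b : C) (s : hom a b) (s' : hom b a) :
  s ∘ s' = idm b -> forall z (u v : hom b z), u ∘ s = v ∘ s -> u = v.
Proof.
move=> ss' z u v e.
by rewrite -[u]comp_id_r -[v]comp_id_r -ss' !compA e.
Qed.

Section Coherence.
Variable V : MonoidalCategory.
Implicit Types a b c d : V.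

Lemma lunit_faithful a b (f g : hom a b) : idm 𝟏 ⊠ f = idm 𝟏 ⊠ g -> f = g.
Proof.
move=> e; apply: (epi_of_section (lunit'K a)).
by rewrite -!lunit_nat e.
Qed.

Lemma runit_faithful a b (f g : hom a b) : f ⊠ idm 𝟏 = g ⊠ idm 𝟏 -> f = g.
Proof.
move=> e; apply: (epi_of_section (runit'K a)).
by rewrite -!runit_nat e.
Qed.

Lemma tensm_compl a b c d (g : hom b c) (f : hom a b) :
  (g ∘ f) ⊠ idm d = (g ⊠ idm d) ∘ (f ⊠ idm d).
Proof. by rewrite -tensm_comp comp_id_l. Qed.

Lemma tensm_compr a b c d (g : hom b c) (f : hom a b) :
  idm d ⊠ (g ∘ f) = (idm d ⊠ g) ∘ (idm d ⊠ f).
Proof. by rewrite -tensm_comp comp_id_l. Qed.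

Lemma lunit_tens a b : lunit (a ⊗ b) ∘ assoc 𝟏 a b = lunit a ⊠ idm b.
Proof.
apply: lunit_faithful; rewrite tensm_compr.
apply: (@epi_of_section _ _ _ (assoc 𝟏 (𝟏 ⊗ a) b ∘ (assoc 𝟏 𝟏 a ⊠ idm b))
  ((assoc' 𝟏 𝟏 a ⊠ idm b) ∘ assoc' 𝟏 (𝟏 ⊗ a) b)).
  rewrite -compA (reassoc (esym (tensm_compl _ _ _))) assoc'K tensm_id comp_id_l.
  exact: assoc'K.
rewrite -compA (compA (idm _ ⊠ assoc _ _ _)) pentagon (compA (idm _ ⊠ lunit _)).
rewrite triangle -{1}tensm_id -assoc_nat -triangle (compA (idm 𝟏 ⊠ _)).
by rewrite -assoc_nat -compA -tensm_compl.
Qed.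

Lemma runit_tens a b : (idm a ⊠ runit b) ∘ assoc a b 𝟏 = runit (a ⊗ b).
Proof.
apply: runit_faithful; rewrite tensm_compl.
have mono : forall z (u v : hom z ((a ⊗ b) ⊗ 𝟏)),
    assoc a b 𝟏 ∘ u = assoc a b 𝟏 ∘ v -> u = v.
  move=> z u v e.
  by rewrite -[u]comp_id_l -[v]comp_id_l -assocK -!compA e.
apply: mono.
rewrite compA assoc_nat -(triangle b) tensm_compr -(triangle (a ⊗ b)).
rewrite compA -tensm_id assoc_nat -!compA; congr (_ ∘ _).
by rewrite compA pentagon.
Qed.

Lemma lunit_unit_tens a : lunit (𝟏 ⊗ a) = idm 𝟏 ⊠ lunit a.
Proof.
rewrite -[LHS]comp_id_l -[RHS]comp_id_l -lunitK -!compA; congr (_ ∘ _).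
by rewrite lunit_nat.
Qed.

Lemma lunit_runit_unit : lunit (𝟏 : V) = runit 𝟏.
Proof.
apply: runit_faithful; rewrite -lunit_tens -triangle.
by rewrite lunit_unit_tens.
Qed.

Lemma lunit'_runit'_unit : lunit' (𝟏 : V) = runit' 𝟏.
Proof.
apply: (epi_of_section (lunit'K (𝟏 : V))).
by rewrite lunitK lunit_runit_unit runitK.
Qed.

Lemma lunit'_nat a b (f : hom a b) : (idm 𝟏 ⊠ f) ∘ lunit' a = lunit' b ∘ f.
Proof.
rewrite -[LHS]comp_id_l -(lunitK b) -!compA; congr (_ ∘ _).
by rewrite compA lunit_nat -compA lunit'K comp_id_r.
Qed.

Lemma runit'_nat a b (f : hom a b) : (f ⊠ idm 𝟏) ∘ runit' a = runit' b ∘ f.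
Proof.
rewrite -[LHS]comp_id_l -(runitK b) -!compA; congr (_ ∘ _).
by rewrite compA runit_nat -compA runit'K comp_id_r.
Qed.

Lemma assoc_lunit' a b : assoc 𝟏 a b ∘ (lunit' a ⊠ idm b) = lunit' (a ⊗ b).
Proof.
rewrite -[LHS]comp_id_l -lunitK -!compA (reassoc (lunit_tens _ _)).
by rewrite -tensm_compl lunit'K tensm_id comp_id_r.
Qed.

Lemma assoc_runit' a b : assoc a b 𝟏 ∘ runit' (a ⊗ b) = idm a ⊠ runit' b.
Proof.
rewrite -[LHS]comp_id_l -tensm_id -(runitK b) tensm_compr -!compA.
by rewrite (reassoc (runit_tens _ _)) runit'K comp_id_r.
Qed.

Lemma assoc_runit'_lunit' a b :
  assoc a 𝟏 b ∘ (runit' a ⊠ idm b) = idm a ⊠ lunit' b.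
Proof.
rewrite -[LHS]comp_id_l -tensm_id -(lunitK b) tensm_compr -!compA.
by rewrite (reassoc (triangle _ _)) -tensm_compl runit'K tensm_id comp_id_r.
Qed.

Lemma tensm_swap a b c d (f : hom a b) (g : hom c d) :
  (f ⊠ idm d) ∘ (idm a ⊠ g) = (idm b ⊠ g) ∘ (f ⊠ idm c).
Proof. by rewrite -!tensm_comp !comp_id_l !comp_id_r. Qed.

Lemma tensm_split a b c d (f : hom a b) (g : hom c d) :
  f ⊠ g = (f ⊠ idm d) ∘ (idm a ⊠ g).
Proof. by rewrite -!tensm_comp !comp_id_l !comp_id_r. Qed.

End Coherence.

Record VCategory (V : MonoidalCategory) := {
  vob :> Type;
  vhom : vob -> vob -> V;
  vid : forall a, hom 𝟏 (vhom a a);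
  vcomp : forall a b c, hom (vhom b c ⊗ vhom a b) (vhom a c);
  vcompA : forall a b c d,
    vcomp a b d ∘ (vcomp b c d ⊠ idm (vhom a b))
    = vcomp a c d ∘ (idm (vhom c d) ⊠ vcomp a b c) ∘ assoc _ _ _;
  vcomp_id_l : forall a b, vcomp a b b ∘ (vid b ⊠ idm (vhom a b)) = lunit _;
  vcomp_id_r : forall a b, vcomp a a b ∘ (idm (vhom a b) ⊠ vid a) = runit _ }.

Arguments vhom {_ _} a b.
Arguments vid {_ _} a.
Arguments vcomp {_ _} a b c.

Definition elt (V : MonoidalCategory) (C : VCategory V) (a b : C) : Type :=
  hom 𝟏 (vhom a b).

Section Underlying.
Variables (V : MonoidalCategory) (C : VCategory V).
Implicit Types a b c d : C.

Definition precomp a b c (f : elt a b) : hom (vhom b c) (vhom a c) :=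
  vcomp a b c ∘ (idm _ ⊠ f) ∘ runit' _.

Definition postcomp a b c (g : elt b c) : hom (vhom a b) (vhom a c) :=
  vcomp a b c ∘ (g ⊠ idm _) ∘ lunit' _.

Definition ucomp a b c (g : elt b c) (f : elt a b) : elt a c :=
  vcomp a b c ∘ (g ⊠ f) ∘ lunit' 𝟏.

Lemma postcomp_elt a b c (g : elt b c) (f : elt a b) :
  postcomp a g ∘ f = ucomp g f.
Proof.
by rewrite /postcomp /ucomp -!compA -lunit'_nat (compA (_ ⊠ _)) -tensm_split.
Qed.

Lemma precomp_elt a b c (g : elt b c) (f : elt a b) :
  precomp c f ∘ g = ucomp g f.
Proof.
rewrite /precomp /ucomp -!compA -runit'_nat (compA (_ ⊠ _)) -tensm_swap.
by rewrite -tensm_split lunit'_runit'_unit.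
Qed.

Lemma precomp_vcomp a b c d (f : elt a b) :
  precomp d f ∘ vcomp b c d = vcomp a c d ∘ (idm _ ⊠ precomp c f).
Proof.
rewrite /precomp !tensm_compr -assoc_runit' -!compA.
rewrite (reassoc (esym (assoc_nat _ _ _))) -compA tensm_id.
rewrite !compA -(vcompA a b c d) -!compA.
by rewrite (reassoc (tensm_swap _ _)) -!compA runit'_nat.
Qed.

Lemma postcomp_vcomp a b c d (g : elt c d) :
  postcomp a g ∘ vcomp a b c = vcomp a b d ∘ (postcomp b g ⊠ idm _).
Proof.
rewrite /postcomp !tensm_compl !compA (vcompA a b c d) -!compA.
rewrite (reassoc (assoc_nat _ _ _)) -!compA assoc_lunit' tensm_id.
by rewrite (reassoc (esym (tensm_swap _ _))) -!compA lunit'_nat.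
Qed.

Lemma vcomp_middle a b c d (f : elt b c) :
  vcomp a b d ∘ (precomp d f ⊠ idm _) = vcomp a c d ∘ (idm _ ⊠ postcomp a f).
Proof.
rewrite /precomp /postcomp !tensm_compl !tensm_compr !compA vcompA -!compA.
by rewrite (reassoc (assoc_nat _ _ _)) -!compA assoc_runit'_lunit'.
Qed.

Lemma ucomp_id_l a b (f : elt a b) : ucomp (vid b) f = f.
Proof.
by rewrite -postcomp_elt /postcomp vcomp_id_l lunit'K comp_id_l.
Qed.

Lemma ucomp_id_r a b (f : elt a b) : ucomp f (vid a) = f.
Proof.
by rewrite -precomp_elt /precomp vcomp_id_r runit'K comp_id_l.
Qed.

Lemma ucompA a b c d (h : elt c d) (g : elt b c) (f : elt a b) :
  ucomp h (ucomp g f) = ucomp (ucomp h g) f.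
Proof.
rewrite -(postcomp_elt h) {1}/ucomp !compA postcomp_vcomp.
rewrite -(compA _ _ (g ⊠ f)) -tensm_comp comp_id_l.
by rewrite postcomp_elt.
Qed.

Definition underlying : Category := {|
  ob := C;
  hom := @elt V C;
  idm := vid;
  comp := ucomp;
  comp_id_l := ucomp_id_l;
  comp_id_r := ucomp_id_r;
  compA := ucompA |}.

(* Transport of hom-objects along equalities of objects: the identity of [V]
   whenever both equalities are [eq_refl]. *)
Definition hcast a a' b b' (Ha : a = a') (Hb : b = b') :
    hom (vhom a b) (vhom a' b') :=
  match Ha in _ = x, Hb in _ = y return hom (vhom a b) (vhom x y) with
  | eq_refl, eq_refl => idm _
  end.

Lemma hcast_trans a a' a'' b b' b'' (Ha : a = a') (Hb : b = b')
    (Ha' : a' = a'') (Hb' : b' = b'') :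
  hcast Ha' Hb' ∘ hcast Ha Hb = hcast (eq_trans Ha Ha') (eq_trans Hb Hb').
Proof. by destruct Ha, Hb, Ha', Hb'; rewrite comp_id_l. Qed.

Lemma hcastK a a' b b' (Ha : a = a') (Hb : b = b') :
  hcast (eq_sym Ha) (eq_sym Hb) ∘ hcast Ha Hb = idm _.
Proof. by destruct Ha, Hb; rewrite comp_id_l. Qed.

Lemma hcastKV a a' b b' (Ha : a = a') (Hb : b = b') :
  hcast Ha Hb ∘ hcast (eq_sym Ha) (eq_sym Hb) = idm _.
Proof. by destruct Ha, Hb; rewrite comp_id_l. Qed.

Lemma hcast_inj a a' b b' (Ha : a = a') (Hb : b = b') (z : V)
    (u v : hom z (vhom a b)) : hcast Ha Hb ∘ u = hcast Ha Hb ∘ v -> u = v.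
Proof. by destruct Ha, Hb; rewrite !comp_id_l. Qed.

Lemma hcast_vid a a' (Ha : a = a') : hcast Ha Ha ∘ vid a = vid a'.
Proof. by destruct Ha; rewrite comp_id_l. Qed.

Lemma hcast_vcomp a a' b b' c c' (Ha : a = a') (Hb : b = b') (Hc : c = c') :
  hcast Ha Hc ∘ vcomp a b c = vcomp a' b' c' ∘ (hcast Hb Hc ⊠ hcast Ha Hb).
Proof. by destruct Ha, Hb, Hc; rewrite /= tensm_id comp_id_l comp_id_r. Qed.

Lemma hcast_precomp a a' b b' c c' (Ha : a = a') (Hb : b = b') (Hc : c = c')
    (f : elt a b) :
  hcast Ha Hc ∘ precomp c f = precomp c' (hcast Ha Hb ∘ f) ∘ hcast Hb Hc.
Proof. by destruct Ha, Hb, Hc; rewrite /= !comp_id_l comp_id_r. Qed.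

Lemma hcast_postcomp a a' b b' c c' (Ha : a = a') (Hb : b = b') (Hc : c = c')
    (g : elt b c) :
  hcast Ha Hc ∘ postcomp a g = postcomp a' (hcast Hb Hc ∘ g) ∘ hcast Ha Hb.
Proof. by destruct Ha, Hb, Hc; rewrite /= !comp_id_l comp_id_r. Qed.

End Underlying.

Record VFunctor (V : MonoidalCategory) (C D : VCategory V) := {
  vfob :> C -> D;
  vfmap : forall a b : C, hom (vhom a b) (vhom (vfob a) (vfob b));
  vfmap_id : forall a : C, vfmap a a ∘ vid a = vid (vfob a);
  vfmap_comp : forall a b c : C,
    vfmap a c ∘ vcomp a b c = vcomp _ _ _ ∘ (vfmap b c ⊠ vfmap a b) }.

Arguments vfmap {_ _ _} _ a b.

Definition umap (V : MonoidalCategory) (C D : VCategory V) (F : VFunctor C D)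
    (a b : C) (f : elt a b) : elt (F a) (F b) := vfmap F a b ∘ f.

Section FunctorOperations.
Variable V : MonoidalCategory.

Definition vfunctor_id (C : VCategory V) : VFunctor C C.
Proof.
refine {| vfob := fun a => a; vfmap := fun a b => idm _ |}.
- by move=> a; rewrite comp_id_l.
- by move=> a b c; rewrite tensm_id comp_id_l comp_id_r.
Defined.

Definition vfunctor_comp (C D E : VCategory V) (G : VFunctor D E)
    (F : VFunctor C D) : VFunctor C E.
Proof.
refine {| vfob := fun a => G (F a);
          vfmap := fun a b => vfmap G (F a) (F b) ∘ vfmap F a b |}.
- by move=> a; rewrite -compA !vfmap_id.
- by move=> a b c; rewrite -compA vfmap_comp compA vfmap_comp -compA -tensm_comp.
Defined.

Lemma vfmap_precomp (C D : VCategory V) (F : VFunctor C D) (a b c : C)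
    (f : elt a b) :
  vfmap F a c ∘ precomp c f = precomp (F c) (umap F f) ∘ vfmap F b c.
Proof.
rewrite /precomp !compA vfmap_comp -!compA -runit'_nat; congr (_ ∘ _).
by rewrite !compA -!tensm_comp !comp_id_r comp_id_l.
Qed.

Lemma vfmap_postcomp (C D : VCategory V) (F : VFunctor C D) (a b c : C)
    (g : elt b c) :
  vfmap F a c ∘ postcomp a g = postcomp (F a) (umap F g) ∘ vfmap F a b.
Proof.
rewrite /postcomp !compA vfmap_comp -!compA -lunit'_nat; congr (_ ∘ _).
by rewrite !compA -!tensm_comp !comp_id_r comp_id_l.
Qed.

End FunctorOperations.

Record VNat (V : MonoidalCategory) (C D : VCategory V) (F G : VFunctor C D) := {
  vnat :> forall a : C, elt (F a) (G a);
  vnatural : forall a b : C,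
    postcomp (F a) (vnat b) ∘ vfmap F a b = precomp (G b) (vnat a) ∘ vfmap G a b }.

Record VNatIso (V : MonoidalCategory) (C D : VCategory V) (F G : VFunctor C D) := {
  vniso :> VNat F G;
  vniso' : VNat G F;
  vnisoK : forall a, ucomp (vniso' a) (vniso a) = vid (F a);
  vniso'K : forall a, ucomp (vniso a) (vniso' a) = vid (G a) }.

Definition opcartesian (V : MonoidalCategory) (E B : VCategory V)
    (p : VFunctor E B) (e e' : E) (chi : elt e e') : Prop :=
  forall d : E,
    is_pullback (precomp d chi) (vfmap p e' d)
                (vfmap p e d) (precomp (p d) (umap p chi)).

Record Opfibration (V : MonoidalCategory) (E B : VCategory V) := {
  opf :> VFunctor E B;
  push : forall (e : E) (b : B) (f : elt (opf e) b), E;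
  push_over : forall (e : E) (b : B) (f : elt (opf e) b), opf (push f) = b;
  chi : forall (e : E) (b : B) (f : elt (opf e) b), elt e (push f);
  chi_over : forall (e : E) (b : B) (f : elt (opf e) b),
    hcast eq_refl (push_over f) ∘ umap opf (chi f) = f;
  chi_opcartesian : forall (e : E) (b : B) (f : elt (opf e) b),
    opcartesian opf (chi f) }.

Arguments push {_ _ _} _ {e b} f.
Arguments push_over {_ _ _} _ {e b} f.
Arguments chi {_ _ _} _ {e b} f.
Arguments chi_over {_ _ _} _ {e b} f.
Arguments chi_opcartesian {_ _ _} _ {e b} f.

Section Fiber.
Variables (V : MonoidalCategory) (HP : HasPullbacks V).
Variables (E B : VCategory V) (p : VFunctor E B) (b : B).

(* [p e = b] is the strict equality of objects of the usual definition, so the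
   hom-map of [p] reaches [vhom b b] only after an [hcast]. *)
Definition fiber_ob : Type := {e : E | p e = b}.

Implicit Types x y z w : fiber_ob.

Definition fiber_over x y : hom (vhom (proj1_sig x) (proj1_sig y)) (vhom b b) :=
  hcast (proj2_sig x) (proj2_sig y) ∘ vfmap p (proj1_sig x) (proj1_sig y).

Definition fiber_pb x y : Pullback (fiber_over x y) (vid b) := HP _ _.

Definition fiber_hom x y : V := fiber_pb x y.

Definition fiber_incl x y : hom (fiber_hom x y) (vhom (proj1_sig x) (proj1_sig y)) :=
  pb_fst (fiber_pb x y).

Definition fiber_unit x y : hom (fiber_hom x y) 𝟏 := pb_snd (fiber_pb x y).

Lemma fiber_sq x y :
  fiber_over x y ∘ fiber_incl x y = vid b ∘ fiber_unit x y.
Proof. exact: proj1 (pb_isP (fiber_pb x y)). Qed.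

Lemma fiber_ext x y (z : V) (u v : hom z (fiber_hom x y)) :
  fiber_incl x y ∘ u = fiber_incl x y ∘ v ->
  fiber_unit x y ∘ u = fiber_unit x y ∘ v -> u = v.
Proof. exact: pullback_jointly_monic (pb_isP (fiber_pb x y)) _ u v. Qed.

Lemma fiber_over_vcomp x y z :
  fiber_over x z ∘ vcomp _ _ _
  = vcomp b b b ∘ (fiber_over y z ⊠ fiber_over x y).
Proof.
rewrite /fiber_over -compA vfmap_comp compA (hcast_vcomp _ (proj2_sig y)).
by rewrite tensm_comp compA.
Qed.

Lemma fiber_vid_subproof x : fiber_over x x ∘ vid (proj1_sig x) = vid b ∘ idm 𝟏.
Proof. by rewrite /fiber_over -compA vfmap_id hcast_vid comp_id_r. Qed.

Lemma fiber_vcomp_subproof x y z :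
  fiber_over x z ∘ (vcomp _ _ _ ∘ (fiber_incl y z ⊠ fiber_incl x y))
  = vid b ∘ (lunit 𝟏 ∘ (fiber_unit y z ⊠ fiber_unit x y)).
Proof.
rewrite compA fiber_over_vcomp -compA -tensm_comp !fiber_sq tensm_comp compA.
by rewrite tensm_split compA vcomp_id_l lunit_nat compA.
Qed.

Definition fiber_vid x : hom 𝟏 (fiber_hom x x) :=
  pb_lift (fiber_pb x x) (fiber_vid_subproof x).

Definition fiber_vcomp x y z :
    hom (fiber_hom y z ⊗ fiber_hom x y) (fiber_hom x z) :=
  pb_lift (fiber_pb x z) (fiber_vcomp_subproof x y z).

Lemma fiber_incl_vid x : fiber_incl x x ∘ fiber_vid x = vid (proj1_sig x).
Proof. exact: pb_lift_fst. Qed.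

Lemma fiber_unit_vid x : fiber_unit x x ∘ fiber_vid x = idm 𝟏.
Proof. exact: pb_lift_snd. Qed.

Lemma fiber_incl_vcomp x y z :
  fiber_incl x z ∘ fiber_vcomp x y z
  = vcomp _ _ _ ∘ (fiber_incl y z ⊠ fiber_incl x y).
Proof. exact: pb_lift_fst. Qed.

Lemma fiber_unit_vcomp x y z :
  fiber_unit x z ∘ fiber_vcomp x y z
  = lunit 𝟏 ∘ (fiber_unit y z ⊠ fiber_unit x y).
Proof. exact: pb_lift_snd. Qed.

Lemma fiber_vcompA w x y z :
  fiber_vcomp w x z ∘ (fiber_vcomp x y z ⊠ idm (fiber_hom w x))
  = fiber_vcomp w y z ∘ (idm (fiber_hom y z) ⊠ fiber_vcomp w x y) ∘ assoc _ _ _.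
Proof.
apply: fiber_ext; rewrite !compA.
  rewrite !fiber_incl_vcomp -!(compA (vcomp _ _ _)) -!tensm_comp.
  rewrite !fiber_incl_vcomp !comp_id_r.
  rewrite -[fiber_incl w x]comp_id_l -[fiber_incl y z]comp_id_l.
  rewrite !tensm_comp !comp_id_l compA vcompA -!compA.
  by rewrite assoc_nat.
rewrite !fiber_unit_vcomp -!(compA (lunit 𝟏)) -!tensm_comp.
rewrite !fiber_unit_vcomp !comp_id_r.
rewrite -[fiber_unit w x]comp_id_l -[fiber_unit y z]comp_id_l.
rewrite !tensm_comp !comp_id_l -!compA -assoc_nat; congr (_ ∘ _).
by rewrite compA -lunit_unit_tens lunit_tens.
Qed.

Lemma fiber_vcomp_id_l x y :
  fiber_vcomp x y y ∘ (fiber_vid y ⊠ idm (fiber_hom x y)) = lunit _.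
Proof.
apply: fiber_ext; rewrite compA.
  rewrite fiber_incl_vcomp -compA -tensm_comp fiber_incl_vid comp_id_r.
  by rewrite tensm_split compA vcomp_id_l lunit_nat.
rewrite fiber_unit_vcomp -compA -tensm_comp fiber_unit_vid comp_id_r.
by rewrite lunit_nat.
Qed.

Lemma fiber_vcomp_id_r x y :
  fiber_vcomp x x y ∘ (idm (fiber_hom x y) ⊠ fiber_vid x) = runit _.
Proof.
apply: fiber_ext; rewrite compA.
  rewrite fiber_incl_vcomp -compA -tensm_comp fiber_incl_vid comp_id_r.
  by rewrite tensm_split tensm_swap compA vcomp_id_r runit_nat.
rewrite fiber_unit_vcomp -compA -tensm_comp fiber_unit_vid comp_id_r.
by rewrite lunit_runit_unit runit_nat.
Qed.

Definition fiber : VCategory V := {|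
  vob := fiber_ob;
  vhom := fiber_hom;
  vid := fiber_vid;
  vcomp := fiber_vcomp;
  vcompA := fiber_vcompA;
  vcomp_id_l := fiber_vcomp_id_l;
  vcomp_id_r := fiber_vcomp_id_r |}.

End Fiber.

Section Transport.
Variables (V : MonoidalCategory) (HP : HasPullbacks V).
Variables (E B : VCategory V) (p : Opfibration E B).

Lemma opcartesian_fiber_lift (b b' : B) (e : E) (He : p e = b)
    (y z : fiber HP p b') (h : elt e (proj1_sig y)) (f : elt b b') :
  opcartesian p h -> hcast He (proj2_sig y) ∘ umap p h = f ->
  forall (q : V) (w : hom q (vhom e (proj1_sig z))) (a : hom q 𝟏),
    hcast He (proj2_sig z) ∘ vfmap p e (proj1_sig z) ∘ w = f ∘ a ->
    exists! u : hom q (vhom y z),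
      fiber_unit HP y z ∘ u = a /\
      precomp (proj1_sig z) h ∘ fiber_incl HP y z ∘ u = w.
Proof.
move=> oh hf q w a ew.
pose w2 := hcast (eq_sym (proj2_sig y)) (eq_sym (proj2_sig z)) ∘ vid b' ∘ a.
have e1 : vfmap p e (proj1_sig z) ∘ w = precomp (p (proj1_sig z)) (umap p h) ∘ w2.
  apply: (hcast_inj (Ha := He) (Hb := proj2_sig z)).
  rewrite compA ew compA (hcast_precomp He (proj2_sig y)) hf /w2.
  rewrite !compA -(compA (precomp _ _)) hcastKV comp_id_r.
  by rewrite precomp_elt ucomp_id_l.
have [v [[v1 v2] _]] := proj2 (oh (proj1_sig z)) _ _ _ e1.
have e2 : fiber_over y z ∘ v = vid b' ∘ a.
  by rewrite /fiber_over -compA v2 /w2 !compA hcastKV comp_id_l.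
exists (pb_lift (fiber_pb HP y z) e2); split.
  by rewrite -compA /fiber_incl pb_lift_fst /fiber_unit pb_lift_snd.
move=> u [u1 u2]; apply: fiber_ext; last by rewrite u1 /fiber_unit pb_lift_snd.
rewrite {1}/fiber_incl pb_lift_fst.
apply: (pullback_jointly_monic (oh (proj1_sig z))).
  by rewrite compA u2 v1.
apply: (hcast_inj (Ha := proj2_sig y) (Hb := proj2_sig z)).
rewrite !compA -/(fiber_over y z) e2 fiber_sq -compA; congr (_ ∘ _).
by rewrite u1.
Qed.

Section Arrow.
Variables (b b' : B) (f : elt b b').
Implicit Types x y z : fiber HP p b.

Definition fiber_arrow x : elt (p (proj1_sig x)) b' :=
  hcast (eq_sym (proj2_sig x)) eq_refl ∘ f.

Definition transport_ob x : fiber HP p b' :=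
  exist _ (push p (fiber_arrow x)) (push_over p (fiber_arrow x)).

Definition transport_chi x : elt (proj1_sig x) (proj1_sig (transport_ob x)) :=
  chi p (fiber_arrow x).

Lemma transport_chi_over x :
  hcast (proj2_sig x) (proj2_sig (transport_ob x)) ∘ umap p (transport_chi x) = f.
Proof.
apply: (hcast_inj (Ha := eq_sym (proj2_sig x)) (Hb := eq_refl)).
rewrite -/(fiber_arrow x) -[RHS](chi_over p) compA hcast_trans.
by rewrite eq_trans_sym_inv_r.
Qed.

Lemma transport_map_subproof x y :
  exists! t : hom (vhom x y) (vhom (transport_ob x) (transport_ob y)),
    fiber_unit HP (transport_ob x) (transport_ob y) ∘ t = fiber_unit HP x y /\
    precomp (proj1_sig (transport_ob y)) (transport_chi x)
      ∘ fiber_incl HP (transport_ob x) (transport_ob y) ∘ t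
    = postcomp (proj1_sig x) (transport_chi y) ∘ fiber_incl HP x y.
Proof.
apply: (opcartesian_fiber_lift (y := transport_ob x) (z := transport_ob y)
  (chi_opcartesian p _) (transport_chi_over x)).
rewrite compA -(compA (hcast _ _)) vfmap_postcomp compA.
rewrite (hcast_postcomp _ (proj2_sig y)) transport_chi_over.
rewrite -(compA (postcomp _ _)) -/(fiber_over x y).
rewrite -(compA (postcomp _ _)) fiber_sq compA.
by rewrite postcomp_elt ucomp_id_r.
Qed.

Definition transport_map x y :
    hom (vhom x y) (vhom (transport_ob x) (transport_ob y)) :=
  proj1_sig (constructive_indefinite_description _ (transport_map_subproof x y)).

Lemma transport_map_unit x y :
  fiber_unit HP (transport_ob x) (transport_ob y) ∘ transport_map x y
  = fiber_unit HP x y.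
Proof.
by rewrite /transport_map; case: constructive_indefinite_description => t [[]].
Qed.

Lemma transport_map_incl x y :
  precomp (proj1_sig (transport_ob y)) (transport_chi x)
    ∘ fiber_incl HP (transport_ob x) (transport_ob y) ∘ transport_map x y
  = postcomp (proj1_sig x) (transport_chi y) ∘ fiber_incl HP x y.
Proof.
by rewrite /transport_map; case: constructive_indefinite_description => t [[]].
Qed.

Lemma transport_ext x (z : fiber HP p b') (q : V)
    (u v : hom q (vhom (transport_ob x) z)) :
  fiber_unit HP (transport_ob x) z ∘ u = fiber_unit HP (transport_ob x) z ∘ v ->
  precomp (proj1_sig z) (transport_chi x) ∘ fiber_incl HP (transport_ob x) z ∘ u
  = precomp (proj1_sig z) (transport_chi x) ∘ fiber_incl HP (transport_ob x) z ∘ v ->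
  u = v.
Proof.
move=> e1 e2.
have e3 : hcast (proj2_sig x) (proj2_sig z) ∘ vfmap p (proj1_sig x) (proj1_sig z)
    ∘ (precomp (proj1_sig z) (transport_chi x) ∘ fiber_incl HP (transport_ob x) z ∘ v)
  = f ∘ (fiber_unit HP (transport_ob x) z ∘ v).
  have e4 : hcast (proj2_sig x) (proj2_sig z) ∘ vfmap p (proj1_sig x) (proj1_sig z)
      ∘ precomp (proj1_sig z) (transport_chi x)
    = precomp b' f ∘ fiber_over (transport_ob x) z.
    rewrite -(compA (hcast _ _)) vfmap_precomp (compA (hcast _ _)).
    rewrite (hcast_precomp _ (proj2_sig (transport_ob x))) transport_chi_over.
    by rewrite -(compA (precomp _ _)).
  rewrite (compA (hcast _ _ ∘ _)) (compA (hcast _ _ ∘ _)) e4 -(compA (precomp _ _)).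
  by rewrite fiber_sq (compA (precomp _ _)) precomp_elt ucomp_id_l (compA f).
have [w [_ Hw]] :=
  opcartesian_fiber_lift (y := transport_ob x)
    (chi_opcartesian p _) (transport_chi_over x) e3.
by rewrite -(Hw u) // -(Hw v).
Qed.

Lemma transport_map_id x : transport_map x x ∘ vid x = vid (transport_ob x).
Proof.
apply: transport_ext; rewrite compA.
  by rewrite transport_map_unit /= !fiber_unit_vid.
rewrite transport_map_incl -(compA (postcomp _ _)) -(compA (precomp _ _)) /=.
by rewrite !fiber_incl_vid postcomp_elt precomp_elt ucomp_id_l ucomp_id_r.
Qed.

Lemma transport_map_comp x y z :
  transport_map x z ∘ vcomp x y z
  = vcomp _ _ _ ∘ (transport_map y z ⊠ transport_map x y).
Proof.
apply: transport_ext; rewrite compA.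
  rewrite transport_map_unit compA /= !fiber_unit_vcomp -compA -tensm_comp.
  by rewrite !transport_map_unit.
rewrite transport_map_incl (compA (precomp _ _ ∘ _)).
rewrite -(compA (postcomp _ _)) -(compA (precomp _ _)) /= !fiber_incl_vcomp.
rewrite (compA (postcomp _ _)) (compA (precomp _ _)) postcomp_vcomp precomp_vcomp.
rewrite -!(compA (vcomp _ _ _)) -!tensm_comp !comp_id_l.
rewrite -(transport_map_incl y z) (transport_map_incl x y).
rewrite -(compA (precomp _ _)) -[fiber_incl HP x y in LHS]comp_id_l.
rewrite [X in _ ∘ X = _]tensm_comp (compA (vcomp _ _ _)) vcomp_middle.
by rewrite -(compA (vcomp _ _ _)) -tensm_comp comp_id_l.
Qed.

Definition transport : VFunctor (fiber HP p b) (fiber HP p b') := {|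
  vfob := transport_ob;
  vfmap := transport_map;
  vfmap_id := transport_map_id;
  vfmap_comp := transport_map_comp |}.

End Arrow.
End Transport.

Record PseudofunctorData (C : Category) (V : MonoidalCategory) := {
  pf_ob :> C -> VCategory V;
  pf_map : forall b c : C, hom b c -> VFunctor (pf_ob b) (pf_ob c) }.

Arguments pf_map {_ _} _ {b c} f.

(* The component at [x] of the identity transformation [F f => F g] when
   [f = g]; needed because [f ∘ idm b] and [f] are not convertible. *)
Definition pf_eq (C : Category) (V : MonoidalCategory) (F : PseudofunctorData C V)
    (b c : C) (f g : hom b c) (e : f = g) (x : F b) :
    elt (pf_map F f x) (pf_map F g x) :=
  match e in _ = g' return elt (pf_map F f x) (pf_map F g' x) with
  | eq_refl => vid (pf_map F f x)
  end.

(* The coherence axioms are equalities of [V]-natural transformations, written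
   componentwise: [(G α) x = umap G (α x)] and [(α F) x = α (F x)]. *)
Record Pseudofunctor (C : Category) (V : MonoidalCategory) := {
  pf_data :> PseudofunctorData C V;
  pf_unit : forall b : C, VNatIso (pf_map pf_data (idm b)) (vfunctor_id (pf_data b));
  pf_comp : forall (b c d : C) (f : hom b c) (g : hom c d),
    VNatIso (pf_map pf_data (g ∘ f))
            (vfunctor_comp (pf_map pf_data g) (pf_map pf_data f));
  pf_unit_r : forall (b c : C) (f : hom b c) (x : pf_data b),
    ucomp (umap (pf_map pf_data f) (pf_unit b x)) (pf_comp (idm b) f x)
    = pf_eq (comp_id_r f) x;
  pf_unit_l : forall (b c : C) (f : hom b c) (x : pf_data b),
    ucomp (pf_unit c (pf_map pf_data f x)) (pf_comp f (idm c) x)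
    = pf_eq (comp_id_l f) x;
  pf_assoc : forall (b c d e : C) (f : hom b c) (g : hom c d) (h : hom d e)
      (x : pf_data b),
    ucomp (umap (pf_map pf_data h) (pf_comp f g x)) (pf_comp (g ∘ f) h x)
    = ucomp (ucomp (pf_comp g h (pf_map pf_data f x)) (pf_comp f (h ∘ g) x))
            (pf_eq (compA h g f) x) }.

Definition fiber_transport (V : MonoidalCategory) (HP : HasPullbacks V)
    (E B : VCategory V) (p : Opfibration E B) :
    PseudofunctorData (underlying B) V := {|
  pf_ob := fun b : underlying B => fiber HP p b;
  pf_map := fun (b b' : underlying B) (f : hom b b') => transport HP p f |}.

(* Main.v *)
From Corelib Require Import ssreflect ssrfun.
From Stdlib Require Import IndefiniteDescription.
Require Import Defs.

(** Write [χ_f(x) : x -> f_! x] for the chosen opcartesian map.  A functor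
    [F : E_b -> E_b'] between fibers is pinned down, up to a unique isomorphism,
    as soon as it comes with a [V]-natural family of opcartesian maps
    [x -> F x] over a fixed [f]: the universal property of opcartesian maps
    yields, for two such families [h : x -> F x] and [k : x -> G x], exactly one
    vertical [t : F x -> G x] with [t ∘ h = k] ([comparison_spec]).  Uniqueness
    makes the comparison invertible ([comparisonK]), and its form for maps from
    an arbitrary object of [V] into a hom-object ([opcartesian_ext]) makes it
    [V]-natural ([comparison_natural]).

    Transport along [f] is such a functor, with the family [χ_f]; the identity
    functor is one over the identity of [b], with the family of identities; and
    such functors over [f] and [g] compose to one over [g ∘ f].  So [1_!] is
    compared with the identity functor and [(g f)_!] with [g_! f_!]: these
    comparisons are the structure isomorphisms of the pseudofunctor.

    Each coherence axiom equates two vertical maps out of some [f_! x].  Both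
    sides send [χ_f(x)] to the same composite of chosen opcartesian maps
    ([carries] records this, and is stable under composition and under
    functors), so they agree by uniqueness ([carries_unique]).

    Since [𝟏] may have nontrivial endomorphisms in [V], a map [𝟏 -> E_b(y, z)]
    is more than a map [y -> z] over the identity: it also has a component
    [𝟏 -> 𝟏].  Verticality requires this component to be the identity: the
    underlying map in [E] alone does not determine the map of the fiber. *)

Set Implicit Arguments.
Unset Strict Implicit.
Unset Printing Implicit Defensive.

(** * Composition of elements *)

Section Elements.
Variables (V : MonoidalCategory) (C : VCategory V).
Implicit Types a b c d : C.

Lemma precomp_ucomp a b c d (g : elt b c) (f : elt a b) :
  precomp d (ucomp g f) = precomp d f ∘ precomp d g.
Proof.
rewrite [precomp d g]/precomp !compA precomp_vcomp.
by rewrite -(compA (vcomp _ _ _)) -tensm_compr precomp_elt.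
Qed.

Lemma postcomp_ucomp a b c d (g : elt c d) (f : elt b c) :
  postcomp a (ucomp g f) = postcomp a g ∘ postcomp a f.
Proof.
rewrite [postcomp a f]/postcomp !compA postcomp_vcomp.
by rewrite -(compA (vcomp _ _ _)) -tensm_compl postcomp_elt.
Qed.

Lemma precomp_postcomp a b c d (g : elt c d) (f : elt a b) :
  precomp d f ∘ postcomp b g = postcomp a g ∘ precomp c f.
Proof.
rewrite {2}/precomp !compA postcomp_vcomp -(compA (vcomp _ _ _)) tensm_swap.
by rewrite -!compA runit'_nat !compA.
Qed.

Lemma precomp_vid a d : precomp d (vid a) = idm (vhom a d).
Proof. by rewrite /precomp vcomp_id_r runit'K. Qed.

Lemma hcast_ucomp a a' b b' c c' (Ha : a = a') (Hb : b = b') (Hc : c = c')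
    (g : elt b c) (f : elt a b) :
  hcast Ha Hc ∘ ucomp g f = ucomp (hcast Hb Hc ∘ g) (hcast Ha Hb ∘ f).
Proof. by destruct Ha, Hb, Hc; rewrite /= !comp_id_l. Qed.

Lemma postcomp_vid a d : postcomp a (vid d) = idm (vhom a d).
Proof. by rewrite /postcomp vcomp_id_l lunit'K. Qed.

End Elements.

Lemma umap_ucomp (V : MonoidalCategory) (C D : VCategory V) (F : VFunctor C D)
    (a b c : C) (g : elt b c) (f : elt a b) :
  umap F (ucomp g f) = ucomp (umap F g) (umap F f).
Proof. by rewrite /umap -!precomp_elt compA vfmap_precomp -compA. Qed.

(** * Closure properties of opcartesian maps *)

Lemma pullback_paste (C : Category) (P P' P'' A A' A'' : C)
    (h : hom P' P) (k : hom P'' P') (h0 : hom A' A) (k0 : hom A'' A')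
    (v : hom P A) (v' : hom P' A') (v'' : hom P'' A'') :
  is_pullback h v' v h0 -> is_pullback k v'' v' k0 ->
  is_pullback (h ∘ k) v'' v (h0 ∘ k0).
Proof.
move=> Hh Hk; split.
  by rewrite compA (proj1 Hh) -compA (proj1 Hk) compA.
move=> Q q1 q2 e; rewrite -compA in e.
have [u [[u1 u2] _]] := proj2 Hh _ _ _ e.
have [w [[w1 w2] _]] := proj2 Hk _ _ _ u2.
exists w; split; first by rewrite -compA w1.
move=> w' [e1 e2]; apply: (pullback_jointly_monic Hk); last by rewrite w2.
apply: (pullback_jointly_monic Hh); first by rewrite w1 u1 compA.
by rewrite w1 u2 compA (proj1 Hk) -compA e2.
Qed.

Section Opcartesian.
Variables (V : MonoidalCategory) (E B : VCategory V) (p : VFunctor E B).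

Lemma opcartesian_ucomp (e e' e'' : E) (k : elt e' e'') (h : elt e e') :
  opcartesian p h -> opcartesian p k -> opcartesian p (ucomp k h).
Proof.
move=> oh ok d; rewrite umap_ucomp !precomp_ucomp.
exact: pullback_paste (oh d) (ok d).
Qed.

Lemma opcartesian_vid (e : E) : opcartesian p (vid e).
Proof.
move=> d; rewrite /umap vfmap_id !precomp_vid.
split; first by rewrite comp_id_l comp_id_r.
move=> Q q1 q2 eq; exists q1; split; last by move=> w []; rewrite comp_id_l.
by rewrite eq !comp_id_l.
Qed.

End Opcartesian.

(** * Vertical maps *)

Section Fibers.
Variables (V : MonoidalCategory) (HP : HasPullbacks V).
Variables (E B : VCategory V) (p : Opfibration E B).

Definition fiber_inclusion (b : B) : VFunctor (fiber HP p b) E := {|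
  vfob := fun x : fiber HP p b => proj1_sig x;
  vfmap := fun x y => fiber_incl HP x y;
  vfmap_id := @fiber_incl_vid V HP E B p b;
  vfmap_comp := @fiber_incl_vcomp V HP E B p b |}.

(** The map of [E] underlying a map of the fiber, with its source and target
    in reduced form. *)
Definition total_map (b : B) (y z : fiber HP p b) (t : elt y z) :
  elt (proj1_sig y) (proj1_sig z) := umap (fiber_inclusion b) t.

Lemma total_map_ucomp (b : B) (w y z : fiber HP p b) (s : elt y z) (t : elt w y) :
  total_map (ucomp s t) = ucomp (total_map s) (total_map t).
Proof. exact: (umap_ucomp (fiber_inclusion b)). Qed.

Lemma fiber_incl_postcomp (b : B) (w y z : fiber HP p b) (t : elt y z) :
  fiber_incl HP w z ∘ postcomp w t
  = postcomp (proj1_sig w) (total_map t) ∘ fiber_incl HP w y.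
Proof. exact: (vfmap_postcomp (fiber_inclusion b)). Qed.

Lemma fiber_incl_precomp (b : B) (w y z : fiber HP p b) (t : elt y z) :
  fiber_incl HP y w ∘ precomp w t
  = precomp (proj1_sig w) (total_map t) ∘ fiber_incl HP z w.
Proof. exact: (vfmap_precomp (fiber_inclusion b)). Qed.

Definition vertical (b : B) (y z : fiber HP p b) (t : elt y z) : Prop :=
  fiber_unit HP y z ∘ t = idm 𝟏.

Lemma vertical_vid (b : B) (y : fiber HP p b) : vertical (vid y).
Proof. exact: fiber_unit_vid. Qed.

Lemma vertical_postcomp (b : B) (w y z : fiber HP p b) (t : elt y z) :
  vertical t -> fiber_unit HP w z ∘ postcomp w t = fiber_unit HP w y.
Proof.
move=> vt; rewrite /postcomp !compA fiber_unit_vcomp -(compA (lunit _)).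
rewrite -tensm_comp vt comp_id_r lunit_nat.
by rewrite -compA lunit'K comp_id_r.
Qed.

Lemma vertical_precomp (b : B) (w y z : fiber HP p b) (t : elt y z) :
  vertical t -> fiber_unit HP y w ∘ precomp w t = fiber_unit HP z w.
Proof.
move=> vt; rewrite /precomp !compA fiber_unit_vcomp -(compA (lunit _)).
rewrite -tensm_comp vt comp_id_r lunit_runit_unit runit_nat.
by rewrite -compA runit'K comp_id_r.
Qed.

Lemma vertical_ucomp (b : B) (w y z : fiber HP p b) (s : elt y z) (t : elt w y) :
  vertical s -> vertical t -> vertical (ucomp s t).
Proof.
by move=> vs vt; rewrite /vertical -postcomp_elt compA vertical_postcomp.
Qed.

(** A map into [E_b(y, z)] amounts to its components in [E(y, z)] and [𝟏].  As
    [h] is opcartesian, the former amounts to its restriction along [h] and its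
    image in a hom-object of [B], and this image is fixed by the component in
    [𝟏] because [E_b(y, z)] lies over the identity of [b]. *)
Lemma opcartesian_ext (b : B) (e : E) (y z : fiber HP p b)
    (h : elt e (proj1_sig y)) (q : V) (u v : hom q (vhom y z)) :
  opcartesian p h ->
  fiber_unit HP y z ∘ u = fiber_unit HP y z ∘ v ->
  precomp (proj1_sig z) h ∘ (fiber_incl HP y z ∘ u)
  = precomp (proj1_sig z) h ∘ (fiber_incl HP y z ∘ v) ->
  u = v.
Proof.
move=> oh e1 e2; apply: fiber_ext => //.
apply: (pullback_jointly_monic (oh _)) => //.
apply: (hcast_inj (Ha := proj2_sig y) (Hb := proj2_sig z)).
rewrite !compA -!/(fiber_over y z) fiber_sq -!compA.
by congr (_ ∘ _).
Qed.

(** When [h] is opcartesian and [k] lies over the same map as [h], exactly one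
    [t] satisfies this relation.  Coherence proofs compute with the relation,
    which composes, rather than with the [t] that it determines. *)
Definition carries (b : B) (e : E) (y z : fiber HP p b) (t : elt y z)
    (h : elt e (proj1_sig y)) (k : elt e (proj1_sig z)) : Prop :=
  vertical t /\ ucomp (total_map t) h = k.

Lemma carries_vid (b : B) (e : E) (y : fiber HP p b) (h : elt e (proj1_sig y)) :
  carries (vid y) h h.
Proof.
split; first exact: vertical_vid.
by rewrite /total_map /umap vfmap_id ucomp_id_l.
Qed.

Lemma carries_ucomp (b : B) (e : E) (w y z : fiber HP p b) (s : elt y z)
    (t : elt w y) (h : elt e (proj1_sig w)) (k : elt e (proj1_sig y))
    (l : elt e (proj1_sig z)) :
  carries t h k -> carries s k l -> carries (ucomp s t) h l.
Proof.
move=> [vt <-] [vs <-]; split; first exact: vertical_ucomp.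
by rewrite total_map_ucomp ucompA.
Qed.

Lemma carries_precomp (b : B) (d e : E) (y z : fiber HP p b) (t : elt y z)
    (h : elt e (proj1_sig y)) (k : elt e (proj1_sig z)) (m : elt d e) :
  carries t h k -> carries t (ucomp h m) (ucomp k m).
Proof. by move=> [vt <-]; split=> //; rewrite ucompA. Qed.

Lemma carries_unique (b : B) (e : E) (y z : fiber HP p b) (s t : elt y z)
    (h : elt e (proj1_sig y)) (k : elt e (proj1_sig z)) :
  opcartesian p h -> carries s h k -> carries t h k -> s = t.
Proof.
move=> oh [vs es] [vt et]; apply: (opcartesian_ext oh); first by rewrite vs vt.
by rewrite !precomp_elt -/(total_map s) es -et.
Qed.

Lemma carries_exists (b b' : B) (f : elt b b') (x : fiber HP p b)
    (y z : fiber HP p b') (h : elt (proj1_sig x) (proj1_sig y))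
    (k : elt (proj1_sig x) (proj1_sig z)) :
  opcartesian p h ->
  hcast (proj2_sig x) (proj2_sig y) ∘ umap p h = f ->
  hcast (proj2_sig x) (proj2_sig z) ∘ umap p k = f ->
  exists t : elt y z, carries t h k.
Proof.
move=> oh eh ek.
have e : hcast (proj2_sig x) (proj2_sig z)
    ∘ vfmap p (proj1_sig x) (proj1_sig z) ∘ k = f ∘ idm 𝟏.
  by rewrite -compA comp_id_r.
have [t [[vt et] _]] := opcartesian_fiber_lift oh eh e.
by exists t; split=> //; rewrite -precomp_elt compA.
Qed.

(** * Functors between fibers with an opcartesian family over a fixed map *)

(** The maps [h x] form a [V]-natural transformation from the inclusion of
    [E_b] in [E] to [F] followed by the inclusion of [E_b'], and [F] commutes
    with the projections of the fiber homs to [𝟏]. *)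
Record OpcartesianLift (b b' : B) (f : elt b b')
    (F : VFunctor (fiber HP p b) (fiber HP p b')) := {
  lift_map :> forall x : fiber HP p b, elt (proj1_sig x) (proj1_sig (F x));
  lift_natural : forall x y : fiber HP p b,
    precomp (proj1_sig (F y)) (lift_map x)
      ∘ (fiber_incl HP (F x) (F y) ∘ vfmap F x y)
    = postcomp (proj1_sig x) (lift_map y) ∘ fiber_incl HP x y;
  lift_opcartesian : forall x, opcartesian p (lift_map x);
  lift_over : forall x,
    hcast (proj2_sig x) (proj2_sig (F x)) ∘ umap p (lift_map x) = f;
  lift_unit : forall x y,
    fiber_unit HP (F x) (F y) ∘ vfmap F x y = fiber_unit HP x y }.

(** On underlying maps this is the naturality of [h] at [t]. *)
Lemma carries_umap (b b' : B) (f : elt b b')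
    (F : VFunctor (fiber HP p b) (fiber HP p b')) (h : OpcartesianLift f F)
    (e : E) (x y : fiber HP p b) (t : elt x y) (m : elt e (proj1_sig x))
    (n : elt e (proj1_sig y)) :
  carries t m n -> carries (umap F t) (ucomp (h x) m) (ucomp (h y) n).
Proof.
move=> [vt <-]; split.
  by rewrite /vertical /umap compA (lift_unit h).
rewrite !ucompA; congr (ucomp _ _).
rewrite -precomp_elt -(postcomp_elt (h y)) /umap /=.
by rewrite 2!compA -(compA (precomp _ _)) lift_natural compA.
Qed.

Definition transport_lift (b b' : B) (f : elt b b') :
  OpcartesianLift f (transport HP p f).
Proof.
refine {| lift_map := fun x => transport_chi f x
            : elt (proj1_sig x) (proj1_sig (transport HP p f x)) |}.
- by move=> x y; rewrite /= compA transport_map_incl.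
- by move=> x; apply: chi_opcartesian.
- exact: transport_chi_over.
- exact: transport_map_unit.
Defined.

Definition id_lift (b : B) : OpcartesianLift (vid b) (vfunctor_id (fiber HP p b)).
Proof.
refine {| lift_map := fun x => vid (proj1_sig x)
            : elt (proj1_sig x) (proj1_sig (vfunctor_id (fiber HP p b) x)) |}.
- by move=> x y /=; rewrite precomp_vid postcomp_vid comp_id_r.
- by move=> x; apply: opcartesian_vid.
- by move=> x /=; rewrite /umap vfmap_id hcast_vid.
- by move=> x y; rewrite comp_id_r.
Defined.

Definition comp_lift (b c d : B) (f : elt b c) (g : elt c d)
    (F : VFunctor (fiber HP p b) (fiber HP p c))
    (G : VFunctor (fiber HP p c) (fiber HP p d))
    (h : OpcartesianLift f F) (k : OpcartesianLift g G) :
  OpcartesianLift (ucomp g f) (vfunctor_comp G F).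
Proof.
refine {| lift_map := fun x => ucomp (k (F x)) (h x)
            : elt (proj1_sig x) (proj1_sig (vfunctor_comp G F x)) |}.
- move=> x y /=; rewrite postcomp_ucomp precomp_ucomp.
  rewrite -(compA (postcomp _ (k _))) -(lift_natural h) -(compA (precomp _ (h _))).
  rewrite (compA (fiber_incl _ _ _)) (compA (precomp _ (k _))).
  rewrite (lift_natural k).
  rewrite -(compA (postcomp _ (k _))) (compA (precomp _ (h _))) precomp_postcomp.
  by rewrite -(compA (postcomp _ (k _))).
- move=> x; apply: opcartesian_ucomp; exact: lift_opcartesian.
- by move=> x /=; rewrite umap_ucomp (hcast_ucomp _ (proj2_sig (F x))) !lift_over.
- by move=> x y /=; rewrite compA (lift_unit k) (lift_unit h).
Defined.

(** * Comparison of two such functors *)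

Section Comparison.
Variables (b b' : B) (f : elt b b').
Variables (F G : VFunctor (fiber HP p b) (fiber HP p b')).
Variables (h : OpcartesianLift f F) (k : OpcartesianLift f G).

Lemma comparison_exists (x : fiber HP p b) :
  exists t : elt (F x) (G x), carries t (h x) (k x).
Proof.
exact: carries_exists (lift_opcartesian h x) (lift_over h x) (lift_over k x).
Qed.

Definition comparison (x : fiber HP p b) : elt (F x) (G x) :=
  proj1_sig (constructive_indefinite_description _ (comparison_exists x)).

Lemma comparison_spec (x : fiber HP p b) : carries (comparison x) (h x) (k x).
Proof. by rewrite /comparison; case: constructive_indefinite_description. Qed.

(** It suffices to compare restrictions along [h x].  On the left, naturality of
    [h] and [t ∘ h = k] at [y] give postcomposition with [k y]; on the right,
    [t ∘ h = k] at [x] and naturality of [k] give the same map. *)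
Lemma comparison_natural (x y : fiber HP p b) :
  postcomp (F x) (comparison y) ∘ vfmap F x y
  = precomp (G y) (comparison x) ∘ vfmap G x y.
Proof.
have [vx ex] := comparison_spec x; have [vy ey] := comparison_spec y.
apply: (opcartesian_ext (lift_opcartesian h x)).
  rewrite (compA _ (postcomp (F x) (comparison y))) (vertical_postcomp _ vy).
  rewrite (compA _ (precomp (G y) (comparison x))) (vertical_precomp _ vx).
  by rewrite (lift_unit h) (lift_unit k).
rewrite (compA _ (postcomp (F x) (comparison y))) fiber_incl_postcomp.
rewrite (compA _ (precomp (G y) (comparison x))) fiber_incl_precomp.
rewrite -(compA (postcomp _ _)) (compA (precomp _ (h x))) precomp_postcomp.
rewrite -(compA (postcomp _ _)) (lift_natural h).
rewrite (compA (postcomp _ _)) -postcomp_ucomp ey.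
rewrite -(compA (precomp _ (total_map _))) (compA (precomp _ (h x))).
by rewrite -precomp_ucomp ex (lift_natural k).
Qed.

Definition comparison_nat : VNat F G := Build_VNat comparison_natural.

End Comparison.

Lemma comparisonK (b b' : B) (f : elt b b')
    (F G : VFunctor (fiber HP p b) (fiber HP p b'))
    (h : OpcartesianLift f F) (k : OpcartesianLift f G) (x : fiber HP p b) :
  ucomp (comparison k h x) (comparison h k x) = vid (F x).
Proof.
apply: (carries_unique (lift_opcartesian h x)); last exact: carries_vid.
exact: carries_ucomp (comparison_spec h k x) (comparison_spec k h x).
Qed.

Definition lift_iso (b b' : B) (f : elt b b')
    (F G : VFunctor (fiber HP p b) (fiber HP p b'))
    (h : OpcartesianLift f F) (k : OpcartesianLift f G) : VNatIso F G :=
  @Build_VNatIso V _ _ F G (comparison_nat h k) (comparison_nat k h)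
    (comparisonK h k) (comparisonK k h).

(** * The pseudofunctor of fibers *)

Lemma carries_pf_eq (b b' : underlying B) (f g : hom b b') (e : f = g)
    (x : fiber HP p b) :
  carries (pf_eq (F := fiber_transport HP p) e x)
    (transport_lift f x) (transport_lift g x).
Proof. by destruct e; apply: carries_vid. Qed.

Definition unit_iso (b : B) :
    VNatIso (transport HP p (vid b)) (vfunctor_id (fiber HP p b)) :=
  lift_iso (transport_lift (vid b)) (id_lift b).

Definition comp_iso (b c d : B) (f : elt b c) (g : elt c d) :
    VNatIso (transport HP p (ucomp g f))
            (vfunctor_comp (transport HP p g) (transport HP p f)) :=
  lift_iso (transport_lift (ucomp g f))
    (comp_lift (transport_lift f) (transport_lift g)).

Lemma carries_unit_iso (b : B) (x : fiber HP p b) :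
  carries (unit_iso b x) (transport_lift (vid b) x) (vid (proj1_sig x)).
Proof. exact: comparison_spec. Qed.

Lemma carries_comp_iso (b c d : B) (f : elt b c) (g : elt c d)
    (x : fiber HP p b) :
  carries (comp_iso f g x) (transport_lift (ucomp g f) x)
    (ucomp (transport_lift g (transport HP p f x)) (transport_lift f x)).
Proof. exact: comparison_spec. Qed.

Definition fiber_pseudofunctor : Pseudofunctor (underlying B) V.
Proof.
refine (@Build_Pseudofunctor (underlying B) V (fiber_transport HP p)
  unit_iso comp_iso _ _ _).
- move=> b c f x.
  apply: (carries_unique (lift_opcartesian (transport_lift _) x));
    last exact: carries_pf_eq.
  apply: carries_ucomp (carries_comp_iso _ _ _) _.
  (* [carries_umap] puts [χ_f(x)] after the identity that [unit_iso] reaches. *)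
  rewrite -[transport_lift f x in X in carries _ _ X]ucomp_id_r.
  exact: carries_umap (carries_unit_iso x).
- move=> b c f x.
  apply: (carries_unique (lift_opcartesian (transport_lift _) x));
    last exact: carries_pf_eq.
  apply: carries_ucomp (carries_comp_iso _ _ _) _.
  (* Here the identity comes after [χ_f(x)], at the object [f_! x]. *)
  rewrite -[transport_lift f x in X in carries _ _ X]ucomp_id_l.
  exact: carries_precomp (carries_unit_iso _).
- move=> b c d e f g h x.
  apply: (carries_unique (lift_opcartesian (transport_lift _) x)).
    (* Both sides reach [χ_h ∘ χ_g ∘ χ_f], here through [χ_h ∘ χ_(g f)] and
       below through [χ_(h g) ∘ χ_f]. *)
    apply: carries_ucomp (carries_comp_iso _ _ _) _.
    exact: carries_umap (carries_comp_iso _ _ _).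
  apply: carries_ucomp (carries_pf_eq _ _) _.
  apply: carries_ucomp (carries_comp_iso _ _ _) _.
  rewrite ucompA.
  exact: carries_precomp (carries_comp_iso _ _ _).
Defined.

End Fibers.

Theorem proposition3p13 (V : MonoidalCategory) (HP : HasPullbacks V)
    (E B : VCategory V) (p : Opfibration E B) :
  exists F : Pseudofunctor (underlying B) V, pf_data F = fiber_transport HP p.
Proof. by exists (fiber_pseudofunctor HP p). Qed.
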